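(* Let $F$ and $H$ be sets of primes with $H\setminus F\neq\emptyset$, and pick $q\in H\setminus F$. Let $\alpha=2$ and, for each $n\geq2$, let $d_{n,1}=\frac{-1}{q^n}$ and $d_{n,2}=\frac{2}{q^n}$. Then System $( * )$ has solutions with all variables in $\mathbb N$, and is strongly centrally partition regular over $\mathbb G_H$, but is not partition regular over $\mathbb G_F$.
   Context: $\mathbb N$ denotes the positive integers. For a set $F$ of primes, $\mathbb G_F=\{a/b: a\in\mathbb Z,\ b\in\mathbb N,\ \text{all prime factors of } b \text{ lie in } F\}$. System $( * )$ with $\alpha=2$ is the infinite system of linear equations in unknowns $y_1,y_2$, $x_{n,j}$, $z_n$ ($n\geq2$, $1\leq j\leq n$) consisting of, for every $n\geq2$, the equation $x_{n,1}+\cdots+x_{n,n}+d_{n,1}y_1+d_{n,2}y_2=z_n$. A system is partition regular over a set $S\subseteq\mathbb R$ if, whenever $S\setminus\{0\}$ is finitely coloured, there is a solution with all variables in one colour class. For a commutative semigroup $(S,+)$ with the discrete topology, $\beta S$ is the Stone–Čech compactification, whose points are the ultrafilters on $S$. The operation extends to $\beta S$ by: $A\in p+q$ iff $\{x\in S:-x+A\in q\}\in p$, where $-x+A=\{y\in S:x+y\in A\}$; $\beta S$ is then a compact right topological semigroup with smallest two-sided ideal $K(\beta S)$, and idempotents in $K(\beta S)$ are minimal idempotents. $A\subseteq S$ is central if it belongs to some minimal idempotent. A system is strongly centrally partition regular over $S$ if whenever $C$ is a central subset of $S$, there is a solution with all variables taking values in $C$ and distinct variables taking different values. *)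

(* Defs.v *)
From HB Require Import structures.
From mathcomp Require Import all_boot all_order all_algebra.
From mathcomp Require Import boolp classical_sets filter.

Set Implicit Arguments.
Unset Strict Implicit.
Unset Printing Implicit Defensive.

Import Order.TTheory GRing.Theory Num.Theory.
Local Open Scope classical_set_scope.
Local Open Scope ring_scope.

Record beta (S : Type) := Beta {
  beta_sets :> set S -> Prop;
  beta_ultra : UltraFilter (beta_sets : set_system S) }.

#[global] Existing Instance beta_ultra.

Section BetaSemigroup.
Variable S : addSemigroupType.

Definition shift_preimage (x : S) (A : set S) : set S := [set y | A (x + y)].

Definition beta_add_sets (p q : beta S) : set_system S :=
  [set A | p [set x | q (shift_preimage x A)]].

Fact beta_add_ultra (p q : beta S) : UltraFilter (beta_add_sets p q).
Proof.
have up (r : beta S) (A B : set S) : A `<=` B -> r A -> r B.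
  exact: (@filterS S r _ A B).
have cap (r : beta S) (A B : set S) : r A -> r B -> r (A `&` B).
  exact: (@filterI S r _ A B).
have top (r : beta S) : r setT by exact: (@filterT S r _).
have bot (r : beta S) : ~ r set0 by exact: (@filter_not_empty S r _).
have ult (r : beta S) (A : set S) : r A \/ r (~` A).
  exact: (@in_ultra_setVsetC S r A _).
have pP : ProperFilter (beta_add_sets p q).
  split=> [p0|]; last split.
  - by apply: (bot p); apply: up p0 => x; exact: bot.
  - by apply: up (top p) => x _; exact: top.
  - move=> A B pA pB; apply: up (cap _ _ _ pA pB) => x [qA qB].
    exact: cap.
  - move=> A B AB; apply: (@up) => x; apply: (@up) => y; exact: AB.
split=> // G GP sG; rewrite eqEsubset; split=> // A GA.
have [//|pN] := ult p [set x | q (shift_preimage x A)].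
have /sG GN : beta_add_sets p q (~` A).
  apply: (up _ _ _ _ pN) => x qN; have [//|] := ult q (shift_preimage x A).
  by apply: (@up).
exfalso; apply: (@filter_not_empty _ G GP).
by rewrite -(setICr A); apply: filterI.
Qed.

Definition beta_add (p q : beta S) : beta S := Beta (beta_add_ultra p q).

Definition two_sided_ideal (I : set (beta S)) : Prop :=
  I !=set0 /\
  forall p q, I q -> I (beta_add p q) /\ I (beta_add q p).

(* The smallest two-sided ideal, as the intersection of all of them; that this
   intersection is itself a (nonempty) ideal is a theorem about beta S. *)
Definition K_beta : set (beta S) := \bigcap_(I in two_sided_ideal) I.

Definition minimal_idempotent (p : beta S) : Prop :=
  beta_add p p = p /\ K_beta p.

Definition central (A : set S) : Prop :=
  exists2 p : beta S, minimal_idempotent p & p A.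

End BetaSemigroup.

Section Carrier.
Variables (R : nmodType) (S : addrClosed R).

Definition carrier := {x : R | x \in S}.

HB.instance Definition _ := SubChoice.on carrier.
HB.instance Definition _ :=
  GRing.SubChoice_isSubNmodule.Build R _ carrier (rpred0D S).

End Carrier.

(* A system in the unknowns V is given by its set of solutions in R. *)
Section PartitionRegularity.
Variables (V : Type) (R : nmodType) (sys : set (V -> R)).

Definition has_solution_in (A : set R) : Prop :=
  exists2 s : V -> R, sys s & forall v, A (s v).

(* Only the values of the colouring c on S \ {0} matter. *)
Definition partition_regular (S : {pred R}) : Prop :=
  forall (k : nat) (c : R -> 'I_k), exists i : 'I_k,
    has_solution_in [set x | [/\ x \in S, x != 0 & c x = i]].

Definition strongly_centrally_partition_regular (S : addrClosed R) : Prop :=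
  forall C : set (carrier S), central C ->
    exists s : V -> carrier S,
      [/\ sys (fun v => val (s v)), injective s & forall v, C (s v)].

End PartitionRegularity.

Section GF.
Variable F : set nat.

Definition GF : {pred rat} := fun x => `[< exists (a : int) (b : nat),
  [/\ (0 < b)%N, forall p, prime p -> (p %| b)%N -> F p & x = a%:~R / b%:R] >].

Fact GF_zmod_closed : zmod_closed GF.
Proof.
split=> [|_ _ /asboolP[a [b [b0 bF ->]]] /asboolP[c [d [d0 dF ->]]]].
  apply/asboolP; exists 0, 1%N; split=> // p /prime_gt1 p1; rewrite dvdn1.
  by move=> /eqP p_eq1; rewrite p_eq1 in p1.
apply/asboolP; exists (a * d%:Z - c * b%:Z), (b * d)%N; split.
- by rewrite muln_gt0 b0.
- by move=> p pp; rewrite Euclid_dvdM// => /orP[/bF|/dF]; apply.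
- rewrite -mulNr addf_div ?pnatr_eq0 -?lt0n//.
  by rewrite natrM rmorphB /= !rmorphM /= mulNr.
Qed.

HB.instance Definition _ := GRing.isZmodClosed.Build rat GF GF_zmod_closed.

End GF.

Definition Npos : set rat := [set n%:R | n in [set n : nat | (0 < n)%N]].

Inductive var :=
| var_y1
| var_y2
| var_x (n : nat) of (2 <= n)%N & 'I_n
| var_z (n : nat) of (2 <= n)%N.

(* The index j : 'I_n is shifted: var_x _ j is the unknown x_{n,j+1}. *)
Definition system_star (R : pzRingType) (d1 d2 : nat -> R) : set (var -> R) :=
  [set s | forall (n : nat) (hn : (2 <= n)%N),
    \sum_(j < n) s (var_x hn j) + d1 n * s var_y1 + d2 n * s var_y2 = s (var_z hn)].

(* Main.v *)
(** Let p be a minimal idempotent of beta G containing C, G = GF H, and let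
    R = {x | -x + C in p}.  For a subsemigroup T in p, R is syndetic inside T;
    with T the set of finite sums of elements of R this gives a k such that, for
    all n >= k, every g in T - T can be written as r' - r minus a sum of n
    elements of R, with r, r' in R.  Since T - T has finite index and G is
    divisible by q, it contains (2 y2 - y1) / q^n for all n once it contains y1
    and y2, so all but finitely many equations are solvable whatever y1 and y2
    are.  The finitely many others are solved simultaneously by a pigeonhole
    argument on partial sums of two sequences whose interval sums stay in C, the
    interval sums providing y2 and y1.  Shifting by p-generic elements moves the
    solution into C and makes the variables distinct.

    Over GF F, divisibility by all q^n forces y1 = 2 y2, which is prevented by
    colouring with the parity of the 2-adic valuation. *)

Require Import Defs.
From HB Require Import structures.
From mathcomp Require Import all_boot all_order all_algebra.
From mathcomp Require Import boolp classical_sets filter.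
From mathcomp Require Import ring.
Set Implicit Arguments.
Unset Strict Implicit.
Unset Printing Implicit Defensive.

Import Order.TTheory GRing.Theory Num.Theory.
Local Open Scope classical_set_scope.
Local Open Scope ring_scope.

(** * Ultrafilters and compactness of [beta S] *)

Section BetaBasics.
Variable S : Type.
Implicit Types (p q : beta S) (A B : set S) (X Y : set (beta S)).

Lemma betaS p A B : A `<=` B -> p A -> p B.
Proof. exact: (@filterS S p _ A B). Qed.

Lemma betaI p A B : p A -> p B -> p (A `&` B).
Proof. exact: (@filterI S p _ A B). Qed.

Lemma betaT p : p setT.
Proof. exact: (@filterT S p _). Qed.

Lemma beta_ex p A : p A -> exists x, A x.
Proof. exact: (@filter_ex S p _ A). Qed.

Lemma betaC p A : ~ p A -> p (~` A).
Proof. by move=> NpA; case: (@in_ultra_setVsetC S p A _). Qed.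

Lemma betaNC p A : p (~` A) -> ~ p A.
Proof. by move=> pC pA; have [x []] := beta_ex (betaI pA pC). Qed.

Lemma beta_eq p q : (forall A, p A -> q A) -> p = q.
Proof.
case: p q => [F FU] [G GU] /= FG.
have GF : G = F := @max_filter _ _ FU _ (@ultra_proper _ _ GU) FG.
by move: GU {FG}; rewrite GF => GU; congr Beta; exact: Prop_irrelevance.
Qed.

Lemma beta_extend (F : set_system S) :
  ProperFilter F -> exists p : beta S, forall A, F A -> p A.
Proof. by move=> /ultraFilterLemma[G [GU FG]]; exists (Beta GU). Qed.

(* Closed subsets of beta S, as the hulls of their kernels. *)
Definition kernel X : set_system S := [set A | forall p, X p -> p A].
Definition beta_closed X := forall p, (forall A, kernel X A -> p A) -> X p.

Lemma beta_closed_bigcap (G : set (set (beta S))) :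
  (forall X, G X -> beta_closed X) -> beta_closed (\bigcap_(X in G) X).
Proof.
move=> Gc p pK X GX; apply: Gc => // A XA; apply: pK => q Gq.
by apply: XA; exact: Gq.
Qed.

(** Compactness: the kernels of a chain unite to a proper filter, and any ultrafilter extending it
    lies in every closed member. *)
Lemma beta_closed_chain (G : set (set (beta S))) :
  (forall X, G X -> beta_closed X /\ X !=set0) -> G !=set0 ->
  total_on G subset -> (\bigcap_(X in G) X) !=set0.
Proof.
move=> Gcn [X0 GX0] Gtot.
have FP : ProperFilter [set A | exists2 X, G X & kernel X A].
  split.
    case=> X GX X0A; have [_ [p Xp]] := Gcn X GX.
    by have [] := beta_ex (X0A p Xp).
  split; first by exists X0 => // p _; exact: betaT.
    move=> A B [X GX XA] [Y GY YB].
    have [XY|YX] := Gtot X Y GX GY.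
      exists X => // p Xp; apply: betaI; first exact: XA.
      exact: YB (XY _ Xp).
    exists Y => // p Yp; apply: betaI; last exact: YB.
    exact: XA (YX _ Yp).
  by move=> A B AB [X GX XA]; exists X => // p Xp; apply: betaS AB _; exact: XA.
have [p pF] := beta_extend FP.
exists p => X GX; have [Xc _] := Gcn X GX.
by apply: Xc => A XA; apply: pF; exists X.
Qed.

(** Zorn's lemma, applied to the parts removed from [X]. [P] is kept general so as to cover both
    closed subsemigroups and closed left ideals. *)
Lemma beta_minimal_closed (P : set (set (beta S))) (X : set (beta S)) :
  (forall G : set (set (beta S)), G `<=` P -> P (\bigcap_(Y in G) Y)) ->
  P X -> beta_closed X -> X !=set0 ->
  exists M, [/\ M `<=` X, P M, beta_closed M & M !=set0] /\
    forall Y, Y `<=` M -> P Y -> beta_closed Y -> Y !=set0 -> Y = M.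
Proof.
move=> Pcap PX Xc Xn.
pose Q Y := [/\ P Y, beta_closed Y & Y !=set0].
have [|U [QU Umax]] := @Zorn_bigcup (beta S) [set U | Q (X `\` U)].
  move=> F FQ Ftot.
  have [[U0 FU0]|F0] := pselect (exists U, F U); last first.
    rewrite /= (_ : X `\` _ = X)//; apply/seteqP; split=> [p []//|p Xp].
    by split=> // -[U FU]; case: F0; exists U.
  pose G := [set X `\` U | U in F].
  rewrite /=; have -> : X `\` \bigcup_(U in F) U = \bigcap_(Y in G) Y.
    apply/seteqP; split=> [p [Xp Np] _ [U FU <-]|p Gp].
      by split=> // Up; apply: Np; exists U.
    have [Xp _] := Gp _ (ex_intro2 _ _ U0 FU0 erefl).
    by split=> // -[U FU Up]; have [] := Gp _ (ex_intro2 _ _ U FU erefl).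
  split.
  - by apply: Pcap => _ [U FU <-]; have [] := FQ U FU.
  - by apply: beta_closed_bigcap => _ [U FU <-]; have [] := FQ U FU.
  - apply: beta_closed_chain.
    + by move=> _ [U FU <-]; have [] := FQ U FU.
    + by exists (X `\` U0); exists U0.
    + move=> _ _ [U FU <-] [V FV <-].
      by have [UV|VU] := Ftot U V FU FV; [right|left]; exact: setDS.
exists (X `\` U); split=> [|Y YM PY Yc Yn].
  by case: QU => ? ? ?; split=> // p [].
apply/seteqP; split=> // p [Xp NUp]; apply: contrapT => NYp.
apply: (Umax (~` Y)).
  split=> [|/(_ p NYp)//].
  by move=> r Ur Yr; have [] := YM r Yr.
rewrite /=; have -> : X `\` ~` Y = Y; last by split.
apply/seteqP; split=> [r [_ /contrapT]//|r Yr].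
by split; [have [] := YM r Yr|exact].
Qed.

End BetaBasics.

(** * Idempotents and minimal left ideals *)

Section BetaAdd.
Variable S : addSemigroupType.
Implicit Types (p q r : beta S) (A B : set S) (X Y : set (beta S)).
Local Notation "p '⊕' q" := (beta_add p q) (at level 50, left associativity).

Lemma beta_addE p q A : (p ⊕ q) A = p [set x | q (shift_preimage x A)].
Proof. by []. Qed.

Lemma beta_addA p q r : p ⊕ (q ⊕ r) = p ⊕ q ⊕ r.
Proof.
apply: beta_eq => A; rewrite /= /beta_add_sets /=.
apply: betaS => x; apply: betaS => y; apply: betaS => z.
by rewrite /shift_preimage /= Algebra.addrA.
Qed.

(** Right translation is continuous on a compact space: a point of [X] mapped to [r] is any
    ultrafilter containing the kernel of [X] and the sets [pre A] for [A] in [r]. *)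
Lemma beta_closed_translate X q :
  beta_closed X -> beta_closed [set p ⊕ q | p in X].
Proof.
move=> Xc r rK.
pose pre A := [set x | q (shift_preimage x A)].
have FP : ProperFilter
    [set B | exists A K, [/\ r A, kernel X K & pre A `&` K `<=` B]].
  split.
    case=> A [K [rA XK AK0]].
    apply: betaNC rA; apply: rK => _ [p Xp <-]; apply: betaC => /= pA.
    have [x] := beta_ex (betaI pA (XK _ Xp)); exact: AK0.
  split.
    exists setT, setT; split=> // [|p _]; exact: betaT.
    move=> B1 B2 [A1 [K1 [rA1 XK1 s1]]] [A2 [K2 [rA2 XK2 s2]]].
    exists (A1 `&` A2), (K1 `&` K2); split; first exact: betaI.
      by move=> p Xp; apply: betaI; [exact: XK1|exact: XK2].
    move=> x [qx [Kx1 Kx2]]; split; [apply: s1|apply: s2]; split=> //;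
      by apply: betaS qx => y [].
  move=> B1 B2 sB [A [K [rA XK s]]].
  by exists A, K; split=> //; exact: subset_trans sB.
have [p pF] := beta_extend FP.
have Xp : X p.
  apply: Xc => K XK; apply: pF; exists setT, K.
  by split=> //; exact: betaT.
exists p => //; apply/esym/beta_eq => A rA; apply: pF; exists A, setT.
by split=> // p' _; exact: betaT.
Qed.

Lemma beta_closed_member A : beta_closed [set p : beta S | p A].
Proof. by move=> p; apply. Qed.

Lemma beta_closed_stabilizer X q :
  beta_closed X -> beta_closed (X `&` [set p | p ⊕ q = q]).
Proof.
move=> Xc r rK; split; first by apply: Xc => A XA; apply: rK => p [/XA].
symmetry; apply: beta_eq => A qA; apply: (rK [set x | _]) => p [_ pq].
by rewrite -pq in qA.
Qed.

(** Ellis's argument: for [e] in a minimal closed subsemigroup [M], [M ⊕ e] is again [M], so the [p]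
    in [M] with [p ⊕ e = e] form a nonempty closed subsemigroup. By minimality it is [M], which
    contains [e]. *)
Lemma idempotent_exists X : beta_closed X -> X !=set0 ->
  (forall p q, X p -> X q -> X (p ⊕ q)) -> exists2 e, X e & e ⊕ e = e.
Proof.
move=> Xc Xn Xadd.
pose P : set (set (beta S)) := [set Y | forall p q, Y p -> Y q -> Y (p ⊕ q)].
have Pcap (G : set (set (beta S))) : G `<=` P -> P (\bigcap_(Y in G) Y).
  move=> GP p q Gp Gq Y GY; apply: GP => //; [exact: Gp|exact: Gq].
have [M [[MX PM Mc [e Me]] Mmin]] := beta_minimal_closed Pcap Xadd Xc Xn.
have translateM : [set p ⊕ e | p in M] = M.
  apply: Mmin; last by exists (e ⊕ e), e.
  - by move=> _ [p Mp <-]; exact: PM.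
  - move=> _ _ [p Mp <-] [q Mq <-]; exists (p ⊕ e ⊕ q); last first.
      by rewrite !beta_addA.
    by apply: (PM) => //; exact: PM.
  - exact: beta_closed_translate.
have stabM : M `&` [set p | p ⊕ e = e] = M.
  apply: Mmin; first by move=> p [].
  - move=> p q [Mp pe] [Mq qe]; split; first exact: PM.
    by rewrite /= -beta_addA qe.
  - exact: beta_closed_stabilizer.
  - have : M e by []. rewrite -{1}translateM => -[p Mp pe].
    by exists p.
exists e; first exact: MX.
by have : M e by []; rewrite -stabM => -[].
Qed.

(* Every point of K(beta S) generates a minimal left ideal: the points with
   this property form a two-sided ideal. *)
Lemma K_beta_minimal_left p : K_beta p -> forall x, exists a, a ⊕ (x ⊕ p) = p.
Proof.
move=> Kp; suff : two_sided_ideal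
    [set p : beta S | forall x, exists a, a ⊕ (x ⊕ p) = p].
  by move=> ideal; exact: (Kp _ ideal).
split; last first.
  move=> {Kp}p q qmin; split=> x.
    have [a aq] := qmin (x ⊕ p); exists (p ⊕ a).
    by rewrite (beta_addA x) -beta_addA aq.
  have [a aq] := qmin x; exists a.
  by rewrite (beta_addA x) (beta_addA a) aq.
pose P : set (set (beta S)) := [set Y | forall x p, Y p -> Y (x ⊕ p)].
have Pcap (G : set (set (beta S))) : G `<=` P -> P (\bigcap_(Y in G) Y).
  by move=> GP x q Gq Y GY; apply: GP => //; exact: Gq.
have [M [[_ PM Mc [e Me]] Mmin]] :=
  @beta_minimal_closed _ P setT Pcap (fun _ _ _ => I) (fun _ _ => I)
    (ex_intro _ p I).
exists e => x /=.
have MM : [set a ⊕ (x ⊕ e) | a in setT] = M.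
  apply: Mmin; last by exists (x ⊕ (x ⊕ e)), x.
  - by move=> _ [a _ <-]; do 2 apply: (PM).
  - by move=> y r [a _ <-]; exists (y ⊕ a) => //; rewrite !beta_addA.
  - exact: beta_closed_translate.
by move: Me; rewrite -{1}MM => -[a _ ae]; exists a.
Qed.

End BetaAdd.

(** * Return sets of a minimal idempotent *)

Section Returns.
Variables (G : zmodType) (p : beta G).
Hypothesis pmin : minimal_idempotent p.

Definition returns (C : set G) : set G := [set x | p (shift_preimage x C)].

Section Target.
Variable C : set G.
Hypothesis pC : p C.
Local Notation R := (returns C).

Lemma returns_large : p R.
Proof. by have [pp _] := pmin; move: pC; rewrite -{1}pp. Qed.

Lemma returns_shift x : R x -> p [set u | R (x + u)].
Proof.
have [pp _] := pmin; rewrite /returns /= -{1}pp beta_addE.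
by apply: betaS => u; apply: betaS => y; rewrite /shift_preimage /= addrA.
Qed.

(* Otherwise some eta containing T contains, for every e in T, the set of t
   with t + e outside R. The left ideal beta T + eta + p of beta T then contains
   an idempotent, which generates the same minimal left ideal of beta G as p, so
   that p itself is in beta T + eta + p: this contradicts the choice of eta. *)
Lemma returns_syndetic (T : set G) : p T -> (forall s t, T s -> T t -> T (s + t)) ->
  exists E : seq G, (forall e, e \in E -> T e) /\
    forall t, T t -> exists2 e, e \in E & R (t + e).
Proof.
move=> pT TD; apply: contrapT => Nsynd.
pose esc (E : seq G) := [set t | T t /\ forall e, e \in E -> ~ R (t + e)].
have FP : ProperFilter
    [set B | exists2 E : seq G, forall e, e \in E -> T e & esc E `<=` B].
  split.
    case=> E ET E0; apply: Nsynd; exists E; split=> // t Tt.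
    apply: contrapT => NE; apply: (E0 t); split=> // e eE Re.
    by apply: NE; exists e.
  split; first by exists [::].
    move=> B1 B2 [E1 ET1 s1] [E2 ET2 s2]; exists (E1 ++ E2).
      by move=> e; rewrite mem_cat => /orP[/ET1|/ET2].
    move=> t [Tt tE]; split; [apply: s1|apply: s2]; split=> // e eE;
      by apply: tE; rewrite mem_cat eE ?orbT.
  by move=> B1 B2 sB [E ET s]; exists E => //; exact: subset_trans sB.
have [eta etaF] := beta_extend FP.
have etaT : eta T by apply: etaF; exists [::] => // t [].
have [pp Kp] := pmin.
pose x := beta_add eta p.
pose X := [set beta_add xi x | xi in [set xi : beta G | xi T]].
have subT (xi zeta : beta G) : xi T -> zeta T -> beta_add xi zeta T.
  move=> xiT zT; rewrite beta_addE; apply: betaS xiT => s Ts; apply: betaS zT => t Tt.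
  exact: TD.
have [|||_ [xi xiT <-] ee] := @idempotent_exists _ X.
- exact/beta_closed_translate/beta_closed_member.
- by exists (beta_add p x), p.
- move=> _ _ [xi xiT <-] [zeta zT <-].
  exists (beta_add (beta_add xi x) zeta); last by rewrite !beta_addA.
  by apply: (subT) => //; apply: (subT) => //; exact: subT.
(* Writing [e] for the idempotent [xi ⊕ x], minimality gives [a ⊕ e = p], and therefore
   [p ⊕ e = p]. *)
have [a aE] := K_beta_minimal_left Kp (beta_add xi eta).
rewrite -beta_addA in aE.
have pe : beta_add p (beta_add xi x) = p by rewrite -{1}aE -beta_addA ee.
have : p C by [].
rewrite -pe beta_addA => /(betaI (subT _ _ pT xiT)) /beta_ex[t [Tt]].
rewrite /x /= /beta_add_sets /= => Rt.
have : eta [set s | ~ R (s + t)].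
  apply: etaF; exists [:: t] => [e|s [_ sE]]; first by rewrite inE => /eqP->.
  by apply: sE; rewrite inE.
move=> /betaNC; apply; apply: betaS Rt => s; apply: betaS => y.
by rewrite /shift_preimage /= addrCA addrA.
Qed.

(** The number of summands is recorded because each equation prescribes how many unknowns x it
    has. *)
Definition sumset (k : nat) : set G := [set s | exists xs : seq G,
  [/\ size xs = k, forall x, x \in xs -> R x & s = \sum_(x <- xs) x]].
Definition sums : set G := [set s | exists k, sumset k s].

Lemma sumset1 x : R x -> sumset 1 x.
Proof.
move=> Rx; exists [:: x]; split=> //; last by rewrite big_seq1.
by move=> y; rewrite inE => /eqP->.
Qed.

Lemma sumsetD j k s t : sumset j s -> sumset k t -> sumset (j + k) (s + t).
Proof.
move=> [xs [<- Rxs ->]] [ys [<- Rys ->]]; exists (xs ++ ys).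
rewrite size_cat big_cat; split=> // x.
by rewrite mem_cat => /orP[/Rxs|/Rys].
Qed.

Lemma sumset_sums k s : sumset k s -> sums s.
Proof. by exists k. Qed.

Lemma sums0 : sums 0.
Proof. by exists 0, [::]; rewrite big_nil. Qed.

Lemma sumsD s t : sums s -> sums t -> sums (s + t).
Proof. by move=> [j js] [k kt]; exists (j + k)%N; exact: sumsetD. Qed.

(** For [p]-almost every [u], both [u] and [r + u] are in [R], so summands can be added one at a
    time. *)
Lemma returns_pad r : R r -> forall k, exists2 t, sumset k t & R (r + t).
Proof.
move=> Rr; elim=> [|k [t kt Rrt]].
  by exists 0; [exists [::]; rewrite big_nil|rewrite addr0].
have [u [Ru Rrtu]] := beta_ex (betaI returns_large (returns_shift Rrt)).
exists (t + u); last by rewrite addrA.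
by rewrite -addn1; apply: sumsetD => //; exact: sumset1.
Qed.

(** Syndeticity inside [sums] offers finitely many corrections [e]; [k] bounds their numbers of
    summands, and padding brings the count to exactly [m]. *)
Lemma sums_bounded : exists k, forall s, sums s ->
  forall m, (k <= m)%N -> exists2 t, sumset m t & R (s + t).
Proof.
have [||E [ET Esynd]] := @returns_syndetic sums.
- by apply: betaS returns_large => x /sumset1; exact: sumset_sums.
- exact: sumsD.
have [k kE] : exists k, forall e, e \in E -> exists2 j, (j <= k)%N & sumset j e.
  elim: E ET {Esynd} => [|e E IH] ET; first by exists 0%N.
  have [|k kE] := IH; first by move=> x xE; apply: ET; rewrite inE xE orbT.
  have [|j je] := ET e; first exact: mem_head.
  exists (maxn j k) => x; rewrite inE => /predU1P[->|/kE[i ik ix]].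
    by exists j; rewrite // leq_maxl.
  by exists i; rewrite // leq_max ik orbT.
exists k => s /Esynd[e eE Rse] m km.
have [j jk je] := kE e eE.
have [t mt Rt] := returns_pad Rse (m - j).
exists (e + t); last by rewrite addrA.
by rewrite -(subnKC (leq_trans jk km)); exact: sumsetD.
Qed.

(** The subgroup generated by [R]. *)
Definition diffs : set G := [set g | exists s t, [/\ sums s, sums t & g + t = s]].

Lemma diffs_sums s : sums s -> diffs s.
Proof. by exists s, 0; split=> //; [exact: sums0|rewrite addr0]. Qed.

Lemma diffs0 : diffs 0.
Proof. exact/diffs_sums/sums0. Qed.

Lemma diffsN g : diffs g -> diffs (- g).
Proof. by move=> [s [t [ss st gs]]]; exists t, s; split; rewrite // -gs addKr. Qed.

Lemma diffsD g h : diffs g -> diffs h -> diffs (g + h).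
Proof.
move=> [s [t [ss st gs]]] [u [v [su sv hu]]].
exists (s + u), (t + v); split; try exact: sumsD.
by rewrite addrACA gs hu.
Qed.

Lemma diffsMn g n : diffs g -> diffs (g *+ n).
Proof.
move=> dg; elim: n => [|n IH]; first exact: diffs0.
by rewrite mulrS; exact: diffsD.
Qed.

Lemma diffs_bounded : exists k, forall g, diffs g -> forall m, (k <= m)%N ->
  exists r r' t, [/\ R r, R r', sumset m t & r + t + g = r'].
Proof.
have [k kP] := sums_bounded; exists k => g [s1 [s2 [ss1 ss2 gs]]] m km.
(* First [u] moves [s2] into [R], then [t] moves [s1 + u] into [R]; the common [u] cancels in the
   difference. *)
have [u ku Ru] := kP s2 ss2 k (leqnn k).
have [t mt Rt] := kP (s1 + u) (sumsD ss1 (sumset_sums ku)) m km.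
exists (s2 + u), (s1 + u + t), t; split=> //.
by rewrite -gs addrC -!addrA.
Qed.

(** Finitely many translates of [R] cover [G]; colour [t] by an entry of [E] that carries it into
    [R]. Two indices receive the same colours in all [K] sequences, and the shared entry cancels in
    the difference. *)
Lemma returns_pigeonhole K : exists M, forall g : 'I_K -> nat -> G,
  exists i j, (i < j <= M)%N /\
    forall n, exists r r', [/\ R r, R r' & r + (g n j - g n i) = r'].
Proof.
have [||E [_ Esynd]] := @returns_syndetic setT; rewrite //; first exact: betaT.
have /choice[f fP] (t : G) : exists a : 'I_(size E), R (t + E`_a).
  have [//|e eE Re] := Esynd t; have aE : (index e E < size E)%N by rewrite index_mem.
  by exists (Ordinal aE); rewrite /= nth_index.
exists #|{ffun 'I_K -> 'I_(size E)}| => g.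
pose c (i : 'I_(#|{ffun 'I_K -> 'I_(size E)}|.+1)) := [ffun n => f (g n i)].
have /injectivePn[i0 [j0 neq cij]] : ~~ injectiveb c.
  by apply/negP => /injectiveP/leq_card; rewrite card_ord ltnn.
have [i [j [lt {}cij]]] : exists i j, (i < j <= #|{ffun 'I_K -> 'I_(size E)}|)%N /\
    forall n, f (g n i) = f (g n j).
  have cn n : f (g n i0) = f (g n j0) by move/ffunP/(_ n): cij; rewrite !ffunE.
  have [lt|gt|eq] := ltngtP i0 j0.
  - by exists i0, j0; rewrite lt -ltnS ltn_ord.
  - by exists j0, i0; rewrite gt -ltnS ltn_ord; split=> // n; rewrite cn.
  - by move: neq; rewrite (val_inj eq) eqxx.
exists i, j; split=> // n; exists (g n i + E`_(f (g n i))), (g n j + E`_(f (g n j))).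
by split=> //; rewrite cij addrC addrA subrK.
Qed.

End Target.

(** If [p] were concentrated at one point, 0 would be the only return and the pigeonhole would make
    [f] repeat a value. Generic shifts can therefore avoid any finite list. *)
Lemma minimal_idempotent_nonprincipal (f : nat -> G) : injective f ->
  forall x y, p [set u | x + u <> y].
Proof.
move=> f_inj x y; apply: betaC => py.
have pz : p [set y - x] by apply: betaS py => u <-; rewrite /= addrC addKr.
have [M] := returns_pigeonhole pz 1.
have R0 r : returns [set y - x] r -> r = 0.
  move=> /(betaI pz)/beta_ex[u [-> /=]] /eqP.
  by rewrite /shift_preimage /= -subr_eq0 addrK => /eqP.
move=> /(_ (fun=> f))[i [j [ij /(_ ord0)[r [r' [/R0-> /R0->]]]]]].
by rewrite add0r => /subr0_eq/f_inj ji; move: ij; rewrite ji ltnn.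
Qed.

End Returns.

(** * Solving all equations at once, with [phi n] as division by [q ^ n] *)

Section Solution.
Variables (G : zmodType) (p : beta G) (C : set G) (f : nat -> G).
Hypotheses (pmin : minimal_idempotent p) (pC : p C) (f_inj : injective f).
Variables (q : nat) (phi : nat -> {additive G -> G}).
Hypotheses (phi0 : forall x, phi 0 x = x).
Hypotheses (phiD : forall m n x, phi (m + n)%N x *+ q ^ n = phi m x).
Local Notation R := (returns p C).

Lemma beta_forall (n : nat) (P : nat -> set G) :
  (forall i, (i < n)%N -> p (P i)) -> p [set u | forall i, (i < n)%N -> P i u].
Proof.
elim: n => [_|n IH pP]; first by apply: betaS (betaT p).
apply: betaS (betaI (IH (fun i lt => pP i (ltnW lt))) (pP n (ltnSn n))).
move=> u [Pu Pnu] i; rewrite ltnS leq_eqVlt => /predU1P[->//|]; exact: Pu.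
Qed.

Lemma beta_notin x (s : seq G) : p [set u | x + u \notin s].
Proof.
elim: s => [|y s IH]; first by apply: betaS (betaT p).
have pxy := minimal_idempotent_nonprincipal pmin f_inj x y.
apply: betaS (betaI pxy IH) => u [/= /eqP neq].
by rewrite inE negb_or neq.
Qed.

(* Modulo the subgroup diffs, multiplication by some power Q of q, Q > 1, fixes
   z = phi (n + j) y; as q ^ (n + j) z = y is in diffs, so is z. *)
Lemma diffs_phi y n : diffs p C y -> diffs p C (phi n y).
Proof.
move=> dy.
have [M] := returns_pigeonhole pmin pC 1.
move=> /(_ (fun _ i => phi (n + i)%N y))[i [j [/andP[ij _]]]].
move=> /(_ ord0)[r [r' [Rr Rr' rr']]].
have -> : phi n y = phi (n + j)%N y *+ q ^ j by rewrite phiD.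
apply: diffsMn; set z := phi (n + j)%N y in rr' *.
have ijE : (n + i + (j - i) = n + j)%N by rewrite -addnA subnKC// ltnW.
pose Q := (q ^ (j - i))%N.
have zQ : z *+ Q = phi (n + i)%N y by rewrite /z /Q -ijE phiD.
have dQ : diffs p C (z - z *+ Q).
  exists r', r; split; [exact: sumset_sums (sumset1 Rr')|
    exact: sumset_sums (sumset1 Rr)|by rewrite zQ addrC].
have dQl l : diffs p C (z - z *+ Q ^ l).
  elim: l => [|l IH]; first by rewrite mulr1n subrr; exact: diffs0.
  have -> : z - z *+ Q ^ l.+1 = (z - z *+ Q) + (z - z *+ Q ^ l) *+ Q.
    by rewrite mulrnBl -mulrnA addrA subrK expnSr.
  by apply: diffsD => //; exact: diffsMn.
rewrite -(subrK (z *+ Q ^ (n + j)) z); apply: diffsD => //.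
(* As [j - i] is positive, [q ^ (n + j)] divides [Q ^ (n + j)], and [z *+ q ^ (n + j)] is [y]. *)
have -> : (Q ^ (n + j) = q ^ (n + j) * q ^ ((j - i).-1 * (n + j)))%N.
  by rewrite -expnM -expnD -mulSn prednK// subn_gt0.
by rewrite mulrnA /z -{1}[(n + j)%N]add0n phiD phi0; exact: diffsMn.
Qed.

(** Terms are appended generically: only the finitely many sums ending at the last index change, and
    [p]-almost every new term keeps them in [C] and [R]. The term for [b] also avoids equality with
    the sums of [a]. *)
Lemma interval_sums M : exists a b : nat -> G, forall i j, (i < j <= M)%N ->
  let y2 := \sum_(i <= t < j) a t in let y1 := \sum_(i <= t < j) b t in
  [/\ C y2 /\ R y2, C y1 /\ R y1 & y1 <> y2].
Proof.
pose A := C `&` R.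
have pA : p A by apply: betaI => //; exact: returns_large.
have Ashift x : A x -> p [set u | A (x + u)].
  move=> [Cx Rx]; apply: betaS (betaI (Rx : p _) (returns_shift pmin Rx)) => u.
  by [].
elim: M => [|M [a [b IH]]].
  exists (fun=> 0), (fun=> 0) => i j /andP[ij].
  by rewrite leqn0 => /eqP j0; rewrite j0 in ij.
have ext (c : nat -> G) : (forall i, (i < M)%N -> A (\sum_(i <= t < M) c t)) ->
    p [set u | forall i, (i < M.+1)%N -> A (\sum_(i <= t < M) c t + u)].
  move=> cA; apply: beta_forall => i; rewrite ltnS leq_eqVlt => /predU1P[->|lt].
    by rewrite big_geq//; apply: betaS pA => u; rewrite /= add0r.
  exact/Ashift/cA.
have [|u uP] := beta_ex (ext a _).
  by move=> i iM; have [|[]] := IH i M; rewrite ?iM//=.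
have pv := ext b _.
have [||v [vP vu]] := beta_ex (betaI (pv _) (beta_forall (n := M.+1) (P := fun i =>
    [set v | \sum_(i <= t < M) b t + v <> \sum_(i <= t < M) a t + u]) _)).
- by move=> i iM; have [|_ []] := IH i M; rewrite ?iM//=.
- by move=> i _; exact: (minimal_idempotent_nonprincipal pmin f_inj).
exists (fun t => if t == M then u else a t), (fun t => if t == M then v else b t).
have old (c : nat -> G) w i j : (j <= M)%N ->
    \sum_(i <= t < j) (if t == M then w else c t) = \sum_(i <= t < j) c t.
  move=> jM; apply: eq_big_nat => t /andP[_ tj].
  by rewrite ltn_eqF// (leq_trans tj).
have new (c : nat -> G) w i : (i <= M)%N ->
    \sum_(i <= t < M.+1) (if t == M then w else c t) = \sum_(i <= t < M) c t + w.
  by move=> iM; rewrite big_nat_recr//= eqxx old.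
move=> i j /andP[ij]; rewrite leq_eqVlt => /predU1P[jM|jM] /=.
  rewrite {j}jM ltnS in ij *; rewrite !new//.
  by split; [exact: uP|exact: vP|exact: vu].
by rewrite !old//; apply: IH; rewrite ij.
Qed.

(** [n] counts the unknowns x apart from the one that will come from [r]; hence the index [n.+1] of
    [phi]. *)
Lemma phi_solution : exists y1 y2, [/\ C y1, C y2, y1 <> y2 & forall n,
  exists r r' t, [/\ R r, R r', sumset p C n t &
                     r + t + phi n.+1 (y2 *+ 2 - y1) = r']].
Proof.
have [k kP] := diffs_bounded pmin pC.
have [M MP] := returns_pigeonhole pmin pC k.
have [a [b abP]] := interval_sums M.
(* From [i] to [j], [g n] grows by [y2 *+ n + phi n.+1 (y2 *+ 2 - y1)], so for [n < k] the [n]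
   summands can all be [y2]. *)
pose g (n i : nat) := \sum_(0 <= t < i) (a t *+ n + phi n.+1 (a t *+ 2 - b t)).
have [i [j [ijM gP]]] := MP (fun n : 'I_k => g n).
have [[Cy2 Ry2] [Cy1 Ry1] neq] := abP i j ijM.
set y2 := \sum_(i <= t < j) a t in Cy2 Ry2 neq.
set y1 := \sum_(i <= t < j) b t in Cy1 Ry1 neq.
exists y1, y2; split=> // n.
have [nk|kn] := ltnP n k.
  have [r [r' [Rr Rr' rr']]] := gP (Ordinal nk).
  exists r, r', (y2 *+ n); split=> //.
    exists (nseq n y2); rewrite size_nseq; split=> //.
      by move=> x; rewrite mem_nseq => /andP[_ /eqP->].
    by rewrite big_nseq iter_addr addr0.
  rewrite -rr' -addrA; congr (_ + _).
  have /andP[/ltnW ij _] := ijM.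
  rewrite /g /= (@big_cat_nat _ _ _ i 0 j)//= [RHS]addrC addKr big_split /= sumrMnl.
  by rewrite -raddf_sum sumrB sumrMnl.
apply: kP kn; apply: diffs_phi; apply: diffsD.
  exact/diffsMn/diffs_sums/sumset_sums/sumset1.
exact/diffsN/diffs_sums/sumset_sums/sumset1.
Qed.

(** Each [x] is replaced by [x + u] with [u] generic; the right-hand side moves by the same [u] and
    stays in [R]. *)
Lemma perturb_distinct (s : seq G) r xs : R r -> (forall x, x \in xs -> R x) ->
  forall g r', R r' -> r + \sum_(x <- xs) x + g = r' ->
  exists ys r'', [/\ size ys = size xs, uniq ys,
      forall y, y \in ys -> C y /\ y \notin s, R r'' /\ (xs != [::] -> r'' != r) &
      r + \sum_(y <- ys) y + g = r''].
Proof.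
move=> Rr; elim: xs => [|x xs IH] Rxs g r' Rr' rr'.
  by exists [::], r'.
have [||ys [r'' [szys uys ysP [Rr'' _] rr'']]] := IH _ (x + g) r' Rr'.
- by move=> y yxs; apply: Rxs; rewrite inE yxs orbT.
- by rewrite -rr' big_cons -!addrA; congr (_ + _); exact: addrCA.
have Rx : R x by apply: Rxs; exact: mem_head.
have [u [[[Cxu xu] /= Rr''u] r''u]] := beta_ex (betaI (betaI (betaI
  (Rx : p _) (beta_notin x (ys ++ s))) (returns_shift pmin Rr''))
  (beta_notin r'' [:: r])).
move: xu; rewrite /= mem_cat negb_or => /andP[xuys xus].
exists (x + u :: ys), (r'' + u); split.
- by rewrite /= szys.
- by rewrite /= xuys.
- by move=> y; rewrite inE => /predU1P[->//|]; exact: ysP.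
- by split=> // _; move: r''u; rewrite /= inE.
- rewrite big_cons -rr'' -!addrA; congr (_ + _).
  by rewrite [RHS]addrCA; congr (_ + _); rewrite addrC -addrA.
Qed.

(** One generic [u] added to both sides moves [r] and the right-hand side into [C]; they become the
    remaining unknown x and [z]. *)
Lemma distinct_block (s : seq G) n r r' t g : (0 < n)%N ->
  R r -> R r' -> sumset p C n t -> r + t + g = r' ->
  exists z (xs : seq G), [/\ size xs = n.+1, uniq (z :: xs),
    forall x, x \in z :: xs -> C x /\ x \notin s & \sum_(x <- xs) x + g = z].
Proof.
move=> n0 Rr Rr' [xs [szxs Rxs ->]] rr'.
have [ys [r'' [szys uys ysP [Rr'' neq] rr'']]] := perturb_distinct s Rr Rxs Rr' rr'.
(* Positivity of [n] makes [xs] nonempty; this inequality is what separates [z = r'' + u] from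
   [r + u]. *)
have {}neq : r'' != r by apply: neq; rewrite -size_eq0 szxs -lt0n.
have [u [[[Cru ru] Cr''u] r''u]] := beta_ex (betaI (betaI (betaI
  (Rr : p _) (beta_notin r (ys ++ s))) (Rr'' : p _)) (beta_notin r'' (ys ++ s))).
move: ru r''u; rewrite /= !mem_cat !negb_or => /andP[ruys rus] /andP[r''uys r''us].
exists (r'' + u), (r + u :: ys); split.
- by rewrite /= szys szxs.
- rewrite /= inE negb_or r''uys ruys uys !andbT.
  by apply: contra neq => /eqP/addIr->.
- by move=> x; rewrite !inE => /predU1P[->//|/predU1P[->//|]]; exact: ysP.
- by rewrite big_cons -rr'' (addrAC r) -!addrA (addrC u) !addrA.
Qed.

(** The equations are solved one after the other, each block of values avoiding all earlier ones. *)
Lemma central_solution : exists s : var -> G, [/\ injective s, forall v, C (s v) &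
  forall n (hn : (2 <= n)%N), \sum_(j < n) s (var_x hn j) +
    phi n (s var_y2 *+ 2 - s var_y1) = s (var_z hn)].
Proof.
have [y1 [y2 [Cy1 Cy2 y12 yP]]] := phi_solution.
have /choice[B BP] (sn : seq G * nat) : exists zxs : G * seq G, (2 <= sn.2)%N ->
    [/\ size zxs.2 = sn.2, uniq (zxs.1 :: zxs.2),
       forall x, x \in zxs.1 :: zxs.2 -> C x /\ x \notin sn.1 &
       \sum_(x <- zxs.2) x + phi sn.2 (y2 *+ 2 - y1) = zxs.1].
  case: sn => s [|[|n]]; [by exists (0, [::])|by exists (0, [::])|].
  have [r [r' [t [Rr Rr' nt rr']]]] := yP n.+1.
  have [z [xs zxsP]] := distinct_block s (ltn0Sn n) Rr Rr' nt rr'.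
  by exists (z, xs).
(* [acc n] lists [y1], [y2] and the blocks below [n]. The values of [B] at levels 0 and 1 are
   arbitrary and merely add elements to avoid. *)
pose fix acc n := if n is m.+1
  then (B (acc m, m)).1 :: (B (acc m, m)).2 ++ acc m else [:: y1; y2].
have acc_sub m n : (m <= n)%N -> {subset acc m <= acc n}.
  elim: n => [|n IH]; first by rewrite leqn0 => /eqP->.
  rewrite leq_eqVlt => /predU1P[->//|/IH sub] x /sub xn.
  by rewrite inE mem_cat xn !orbT.
pose s v := match v with
  | var_y1 => y1 | var_y2 => y2
  | @var_x n _ j => nth 0 (B (acc n, n)).2 j
  | @var_z n _ => (B (acc n, n)).1 end.
(* The stage at which a variable is assigned: values at different levels differ by avoidance, those
   at one positive level by uniqueness within the block. *)
pose level v := match v with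
  | var_y1 | var_y2 => 0%N | @var_x n _ _ | @var_z n _ => n end.
have s_block v : (0 < level v)%N ->
    s v \in (B (acc (level v), level v)).1 :: (B (acc (level v), level v)).2
    /\ (2 <= level v)%N.
  case: v => //= n hn => [j _|_]; split; rewrite // inE ?eqxx//.
  by have [szB _ _ _] := BP (acc n, n) hn; rewrite mem_nth ?orbT// szB.
have s_acc v m : (level v < m)%N -> s v \in acc m.
  move=> vm; have [v0|/s_block[vB _]] := posnP (level v).
    apply: (acc_sub 0%N m (leq0n m)); rewrite /= !inE.
    case: v v0 {vm} => [_|_|n hn j n0|n hn n0]; rewrite ?eqxx ?orbT//;
      by have := hn; rewrite {1}(n0 : n = 0%N).
  apply: (acc_sub _ _ vm); rewrite /= -cat_cons mem_cat.
  by apply/orP; left.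
have s_notin v : (0 < level v)%N -> s v \notin acc (level v).
  move=> /s_block[vB v2].
  by have [_ _ /(_ _ vB)[]] := BP (acc (level v), level v) v2.
have s_lt v w : (level v < level w)%N -> s v <> s w.
  move=> vw svw; have /negP := s_notin w (leq_ltn_trans (leq0n _) vw).
  by apply; rewrite -svw; exact: s_acc.
exists s; split.
- move=> v w svw; have [vw|wv|] := ltngtP (level v) (level w).
  + by case: (s_lt v w vw).
  + by case: (s_lt w v wv).
  case: v w svw => [||n hn j|n hn] [||m hm i|m hm] //=.
  all: try by move=> _ E; exfalso; move: hm; rewrite -E.
  all: try by move=> _ E; exfalso; move: hn; rewrite E.
  + by move=> E; case: (y12 (esym E)).
  + move=> + E; subst m; rewrite (bool_irrelevance hm hn).
    have [/= szB /andP[_ uB] _ _] := BP (acc n, n) hn.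
    by move=> /eqP; rewrite nth_uniq ?szB// => /eqP/val_inj->.
  + move=> + E; subst m.
    have [/= szB /andP[/negP NzB _] _ _] := BP (acc n, n) hn.
    by move=> E; case: NzB; rewrite -E mem_nth// szB.
  + move=> + E; subst m.
    have [/= szB /andP[/negP NzB _] _ _] := BP (acc n, n) hn.
    by move=> E; case: NzB; rewrite E mem_nth// szB.
  + by move=> _ E; subst m; rewrite (bool_irrelevance hm hn).
- move=> v; have [v0|/s_block[vB v2]] := posnP (level v); last first.
    by have [_ _ /(_ _ vB)[]] := BP (acc (level v), level v) v2.
  case: v v0 => [_|_|n hn j n0|n hn n0] //;
    by have := hn; rewrite {1}(n0 : n = 0%N).
- move=> n hn; have [/= szB _ _ <-] := BP (acc n, n) hn.
  by congr (_ + _); rewrite (big_nth 0) szB big_mkord.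
Qed.

End Solution.

(** * The positive result over [GF F] for [q] in [F] *)

Section CarrierZmodule.
Variables (R : zmodType) (S : zmodClosed R).

HB.instance Definition _ :=
  GRing.SubNmodule_isSubZmodule.Build R _ (carrier S) (@rpredNr R S).

End CarrierZmodule.

Section DivPow.
Variables (F : set nat) (q : nat).
Hypotheses (Fq : F q) (q_prime : prime q).

Lemma GF_div_pow n x : x \in GF F -> x / q%:R ^+ n \in GF F.
Proof.
move=> /asboolP[a [b [b0 bF ->]]]; apply/asboolP; exists a, (b * q ^ n)%N; split.
- by rewrite muln_gt0 b0 expn_gt0 prime_gt0.
- move=> r r_prime; rewrite Euclid_dvdM// => /orP[/bF|]; first exact.
  by rewrite Euclid_dvdX// dvdn_prime2// => /andP[/eqP->].
- by rewrite natrM natrX invfM mulrA.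
Qed.

Definition div_pow n (x : carrier (GF F)) : carrier (GF F) :=
  exist _ (val x / q%:R ^+ n) (GF_div_pow n (valP x)).

Fact div_pow_is_additive n : zmod_morphism (div_pow n).
Proof. by move=> x y; apply: val_inj; rewrite /= mulrBl. Qed.

HB.instance Definition _ n := GRing.isZmodMorphism.Build
  (carrier (GF F)) (carrier (GF F)) (div_pow n) (div_pow_is_additive n).

Lemma central_system_star : strongly_centrally_partition_regular
  (system_star (fun n => -1 / q%:R ^+ n) (fun n => 2 / q%:R ^+ n)) (GF F).
Proof.
move=> C [p pmin pC].
pose phi n : {additive carrier (GF F) -> carrier (GF F)} := div_pow n.
have q0 n : (q%:R ^+ n : rat) != 0 by rewrite expf_neq0// pnatr_eq0 -lt0n prime_gt0.
have one_GF : (1 : rat) \in GF F.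
  apply/asboolP; exists 1, 1%N; split=> // r /prime_gt1 r1.
  by rewrite dvdn1 => /eqP r_eq1; rewrite r_eq1 in r1.
(* The multiples of 1 witness that the group is infinite, which makes [p] nonprincipal. *)
pose f n : carrier (GF F) := (exist _ 1 one_GF : carrier (GF F)) *+ n.
have f_inj : injective f.
  move=> m n /(congr1 val); rewrite /f !raddfMn /= => /eqP.
  by rewrite eqr_nat => /eqP.
have phi0 x : phi 0 x = x by apply: val_inj; rewrite /= expr0 divr1.
have phiD m n x : phi (m + n)%N x *+ q ^ n = phi m x.
  apply: val_inj; rewrite raddfMn /= -[LHS]mulr_natr natrX exprD invfM mulrA -mulrA.
  by rewrite mulVf// mulr1.
have [s [s_inj sC sE]] := central_solution pmin pC f_inj phi0 phiD.
exists s; split=> // n hn.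
have phiE x : val (phi n x) = val x / q%:R ^+ n by [].
have val_sum (I : Type) (r : seq I) (g : I -> carrier (GF F)) :
    val (\sum_(i <- r) g i) = \sum_(i <- r) val (g i).
  exact: (raddf_sum (val : carrier (GF F) -> rat)).
have valD (x y : carrier (GF F)) : val (x + y) = val x + val y by [].
rewrite -(sE n hn) valD val_sum -addrA; congr (_ + _).
by rewrite phiE raddfB raddfMn; field.
Qed.

End DivPow.

(** * Failure of partition regularity for [q] outside [F] *)

Lemma GF_pow_divisible (F : set nat) (q : nat) (q_prime : prime q)
    (NFq : ~ F q) (w : rat) :
  w \in GF F -> (forall n, (2 <= n)%N -> w / q%:R ^+ n \in GF F) -> w = 0.
Proof.
move=> /asboolP[a [b [b0 _ wE]]] wq.
have q0 n : (q%:R ^+ n : rat) != 0 by rewrite expf_neq0// pnatr_eq0 -lt0n prime_gt0.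
(* With this choice [2 <= n] holds by computation and [q ^ n] exceeds the absolute value of [a], so
   that divisibility of [a] by [q ^ n] forces [a = 0]. *)
pose n := `|a|.+2.
have /asboolP[c [d [d0 dF cdE]]] := wq n isT.
have coqd : coprime (q ^ n) d.
  by rewrite coprimeXl// prime_coprime//; apply/negP => /(dF q q_prime).
have E : a * d%:Z = c * b%:Z * (q ^ n)%:Z.
  apply: (@intr_inj rat); rewrite !intrM -!pmulrn natrX.
  have bn0 : (b%:R : rat) != 0 by rewrite pnatr_eq0 -lt0n.
  have dn0 : (d%:R : rat) != 0 by rewrite pnatr_eq0 -lt0n.
  move: cdE; rewrite wE => /(congr1 (fun x => x * (q%:R ^+ n * b%:R * d%:R))).
  have -> : a%:~R / b%:R / q%:R ^+ n * (q%:R ^+ n * b%:R * d%:R) = a%:~R * d%:R :> rat.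
    by field; rewrite bn0 q0.
  by move=> ->; field.
have qa : (q ^ n %| `|a|)%N.
  rewrite -(Gauss_dvdl _ coqd).
  by have /(congr1 absz) := E; rewrite !abszM /= => ->; exact: dvdn_mull.
suff a0 : a = 0 by rewrite wE a0 mul0r.
apply/eqP; rewrite -absz_eq0 -leqn0 leqNgt; apply/negP => a0.
have := dvdn_leq a0 qa; rewrite leqNgt => /negP; apply.
by rewrite /n (leq_trans _ (ltnW (ltn_expl _ (prime_gt1 q_prime))))// ltnW.
Qed.

(** Parity of the 2-adic valuation: the sum of the two exponents has the parity of their difference
    and stays in [nat]. *)
Definition val2_parity (x : rat) : bool := odd (logn 2 `|numq x| + logn 2 `|denq x|).

Lemma val2_parity_double x : x != 0 -> val2_parity (2 * x) = ~~ val2_parity x.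
Proof.
move=> x0; have x20 : 2 * x != 0 by rewrite mulf_neq0.
(* Cross-multiplying avoids asking whether doubling changes the numerator or the denominator. *)
have E : (2 * `|numq x| * `|denq (2 * x)| = `|numq (2 * x)| * `|denq x|)%N.
  have /(congr1 absz) : 2 * numq x * denq (2 * x) = numq (2 * x) * denq x.
    by apply: (@intr_inj rat); rewrite !intrM !numqE; ring.
  by rewrite !abszM.
have := congr1 (fun k => odd (logn 2 k)) E; rewrite /val2_parity /=.
rewrite !lognM ?muln_gt0 ?absz_gt0 ?numq_eq0 ?denq_eq0//.
rewrite !oddD (_ : logn 2 2 = 1%N)//=.
by do 4 case: (odd _).
Qed.

Lemma system_star_not_regular (F : set nat) (q : nat) (q_prime : prime q)
    (NFq : ~ F q) :
  ~ partition_regular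
    (system_star (fun n => -1 / q%:R ^+ n : rat) (fun n => 2 / q%:R ^+ n)) (GF F).
Proof.
move=> /(_ 2 (fun x => inord (val2_parity x)))[i [s sE si]].
pose w := 2 * s var_y2 - s var_y1.
have sF v : s v \in GF F by have [] := si v.
have /subr0_eq y12 : w = 0.
  apply: (GF_pow_divisible q_prime NFq).
    by rewrite /w mulr2n mulrDl mul1r rpredB// rpredD.
  move=> n hn; have -> : w / q%:R ^+ n = s (var_z hn) - \sum_(j < n) s (var_x hn j).
    rewrite -(sE n hn) /w; ring.
  by rewrite rpredB// rpred_sum.
have [_ y20 c2] := si var_y2.
have [_ _] := si var_y1; rewrite -c2 -y12 => /(congr1 val).
rewrite val2_parity_double//= !inordK; last 2 first.
- by case: val2_parity.
- by case: val2_parity.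
by case: val2_parity.
Qed.

(** * Solutions in the positive integers, and the conclusion *)

Lemma system_star_Npos (q : nat) : has_solution_in
  (system_star (fun n => -1 / q%:R ^+ n : rat) (fun n => 2 / q%:R ^+ n)) Npos.
Proof.
(* Taking [y1 = 2 * y2] cancels the two terms with coefficients, which leaves [n] ones summing to
   [n]. *)
exists (fun v => match v with
  | var_y1 => 2 | var_y2 | var_x _ _ _ => 1 | @var_z n _ => n%:R end).
  move=> n hn; rewrite sumr_const card_ord /=; ring.
move=> [||n hn j|n hn]; [by exists 2%N|by exists 1%N|by exists 1%N|exists n => //].
exact: ltnW.
Qed.

Theorem theorem4p5 (F H : set nat)
  (F_prime : forall p, F p -> prime p) (H_prime : forall p, H p -> prime p)
  (q : nat) (q_HF : (H `\` F) q) :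
  let d1 := fun n : nat => -1 / q%:R ^+ n : rat in
  let d2 := fun n : nat => 2 / q%:R ^+ n : rat in
  [/\ has_solution_in (system_star d1 d2) Npos,
      strongly_centrally_partition_regular (system_star d1 d2) (GF H) &
      ~ partition_regular (system_star d1 d2) (GF F)].
Proof.
have [Hq NFq] := q_HF; move=> d1 d2; split.
- exact: system_star_Npos.
- exact: central_system_star (H_prime q Hq).
- exact: system_star_not_regular (H_prime q Hq) NFq.
Qed.
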